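(* The translation $\mathcal{N}\mathcal{P}$ (Algorithm 5, given in the context), which uses the failure detector $\mathcal{N}$ and outputs the variable $suspect$ at each process, guarantees Strong Completeness and Strong Accuracy.
   Context: Model. $P=\{p_1,\dots,p_n\}$ is a set of $n$ processes; the clock ranges over $\mathbb{N}$. A failure pattern is a function $F:\mathbb{N}\to 2^P$, where $F(t)$ is the set of processes crashed at time $t$; processes fail only by crashing (halting permanently). Put $crashed(F)=\bigcup_{t\in\mathbb{N}}F(t)$ and $correct(F)=P\setminus crashed(F)$; at least one process is correct, and $f$ is the maximum number of processes that may crash in any execution. The system is asynchronous: each process is connected to every other process by a reliable channel, with unbounded but finite message delays. A broadcast message is sent to all processes, including the sender. For this result it is assumed that unique identifiers are available and that every reception can be attributed to the sender. Failure detector $\mathcal{N}$. A history is a function $H:P\times\mathbb{N}\to\{0,1,\dots,n\}$, where $H(q,t)$ is the number of processes that the module of $q$ suspects to have crashed at time $t$. The set $\mathcal{N}(F)$ of histories permitted for $F$ consists of all $H$ satisfying: (Completeness) there is $t\in\mathbb{N}$ such that $H(q,t')\ge |crashed(F)|$ for all $t'\ge t$ and all $q\in P$; (Accuracy) $H(q,t)\le |crashed(F)|$ for all $t\in\mathbb{N}$ and all $q\in correct(F)$. In the algorithm the converse output is used: there $\mathcal{N}$ denotes the number of processes currently believed to be alive, i.e. $n-H(q,t)$ at process $q$ at time $t$. Algorithm 5 (for each process). Initially $r\leftarrow 0$, $suspect\leftarrow\emptyset$, $earlieralive\leftarrow\emptyset$, $lastchange\leftarrow 0$. Loop forever: (1)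 broadcast $(ALIVE,r)$; (2) wait until $(ALIVE,r)$ messages have been received from some set $AL$ of processes with $|AL|=\mathcal{N}$; (3) if $AL\neq earlieralive$ then $lastchange\leftarrow r$; else, if $r\ge lastchange+f+2$, then $suspect\leftarrow P\setminus AL$; (4) $earlieralive\leftarrow AL$; (5) $r\leftarrow r+1$. Properties. A process $p$ suspects $q$ at a given time if $q$ belongs to the variable $suspect$ of $p$ at that time. Strong Completeness: eventually every process that crashes is permanently suspected by every correct process. Strong Accuracy: no process is suspected before it crashes.
   Formalization: Strong Accuracy is proved only for detectors N that do not anticipate crashes (outputs up to t are permitted for every failure pattern agreeing with F up to t); with Accuracy bounded by all crashes, future ones included, it is false. Strong Completeness is unrestricted. *)

(* Defs.v *)
From mathcomp Require Import all_boot.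
From mathcomp Require Import boolp.

Set Implicit Arguments.
Unset Strict Implicit.
Unset Printing Implicit Defensive.

Definition pattern (n : nat) := nat -> {set 'I_n}.

Definition crashed n (F : pattern n) : {set 'I_n} :=
  [set p | `[< exists t, p \in F t >]].

Definition correct n (F : pattern n) : {set 'I_n} := ~: crashed F.

Definition failure_pattern n (f : nat) (F : pattern n) : Prop :=
  [/\ forall t, F t \subset F t.+1, correct F != set0 & #|crashed F| <= f].

Definition history (n : nat) := 'I_n -> nat -> 'I_n.+1.

Definition N_completeness n (F : pattern n) (H : history n) : Prop :=
  exists t, forall t', t <= t' -> forall q, #|crashed F| <= H q t'.

Definition N_accuracy n (F : pattern n) (H : history n) : Prop :=
  forall t q, q \in correct F -> H q t <= #|crashed F|.

Definition detector_N n (F : pattern n) (H : history n) : Prop :=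
  N_completeness F H /\ N_accuracy F H.

(* The outputs up to t do not depend on the crashes after t: they are
   permitted for every failure pattern that agrees with F up to t.
   [N_accuracy] alone does not provide this, because [crashed F] also counts
   the crashes that are still to come; strong accuracy then fails.  Take n = 2,
   f = 1, H constantly 1, and let the second process crash late, without
   having taken a step: the first process gets AL = {itself} in every round
   and suspects the second one in round f + 2, before its crash. *)
Definition realistic n (f : nat) (F : pattern n) (H : history n) : Prop :=
  forall t (F' : pattern n), failure_pattern f F' ->
    (forall s, s <= t -> F' s = F s) ->
    exists H' : history n, detector_N F' H' /\
      forall q s, s <= t -> H' q s = H q s.

(* [todo] is the set of processes to which (ALIVE, round) has not been sent
   yet; the process is in its wait statement when [todo] is empty. *)
Record lstate (n : nat) := LState {
  todo : {set 'I_n};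
  round : nat;
  suspect : {set 'I_n};
  earlieralive : {set 'I_n};
  lastchange : nat }.

Definition init n : lstate n := LState setT 0 set0 set0 0.

Definition next_round n (f : nat) (AL : {set 'I_n}) (s : lstate n) : lstate n :=
  {| todo := setT;
     round := (round s).+1;
     suspect := if AL != earlieralive s then suspect s
                else if lastchange s + f + 2 <= round s then ~: AL
                else suspect s;
     earlieralive := AL;
     lastchange := if AL != earlieralive s then round s else lastchange s |}.

(* One step of a process that has received (ALIVE, round s) from the processes
   in [got] and whose detector reports [alive] processes alive: it sends
   (ALIVE, round s) to the processes in D and its next state is s'.  A
   broadcast may take several steps, so that a crash may interrupt it.  More
   than [alive] messages may have arrived; AL is then any subset of the right
   size. *)
Inductive step n (f alive : nat) (got : {set 'I_n}) (s : lstate n) :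
    {set 'I_n} -> lstate n -> Prop :=
| Send (D : {set 'I_n}) of D \subset todo s & D != set0 :
    step f alive got s D
      (LState (todo s :\: D) (round s) (suspect s) (earlieralive s)
              (lastchange s))
| Proceed (AL : {set 'I_n}) of todo s = set0 & AL \subset got & #|AL| = alive :
    step f alive got s set0 (next_round f AL s)
| KeepWaiting of todo s = set0 & #|got| < alive :
    step f alive got s set0 s.

(* [state e t], [sent e t] and [rcvd e t] describe the system before the steps
   and receptions of time t, hence their values at t.+1 take them into
   account. *)
Record execution (n : nat) := Execution {
  active : nat -> {set 'I_n};  (* the processes that take a step at t *)
  state : nat -> 'I_n -> lstate n;
  sent : nat -> 'I_n -> nat -> {set 'I_n};
    (* sent t p r: destinations to which p has sent (ALIVE, r) *)
  rcvd : nat -> 'I_n -> nat -> {set 'I_n}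
    (* rcvd t p r: senders from which p has received (ALIVE, r) *) }.

Definition initial n (e : execution n) : Prop :=
  forall p, state e 0 p = init n /\
    forall r, sent e 0 p r = set0 /\ rcvd e 0 p r = set0.

Definition takes_step n (f : nat) (H : history n) (e : execution n)
    (t : nat) (p : 'I_n) : Prop :=
  let s := state e t p in
  exists D : {set 'I_n},
    step f (n - H p t) (rcvd e t p (round s)) s D (state e t.+1 p) /\
    forall r, sent e t.+1 p r =
              sent e t p r :|: (if r == round s then D else set0).

Definition is_idle n (e : execution n) (t : nat) (p : 'I_n) : Prop :=
  state e t.+1 p = state e t p /\ forall r, sent e t.+1 p r = sent e t p r.

Definition local_steps n (f : nat) (F : pattern n) (H : history n)
    (e : execution n) : Prop :=
  forall t p, if p \in active e t then p \notin F t /\ takes_step f H e t p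
              else is_idle e t p.

Definition receptions n (F : pattern n) (e : execution n) : Prop :=
  forall t p r, rcvd e t p r \subset rcvd e t.+1 p r /\
    forall q, q \in rcvd e t.+1 p r :\: rcvd e t p r ->
      p \notin F t /\ p \in sent e t q r.

Definition reliable n (F : pattern n) (e : execution n) : Prop :=
  forall t p q r, q \in correct F -> q \in sent e t p r ->
    exists t', p \in rcvd e t' q r.

Definition fair n (F : pattern n) (e : execution n) : Prop :=
  forall p, p \in correct F -> forall t, exists2 t', t <= t' & p \in active e t'.

Definition execution_of n (f : nat) (F : pattern n) (H : history n)
    (e : execution n) : Prop :=
  [/\ initial e, local_steps f F H e, receptions F e, reliable F e & fair F e].

Definition suspects n (e : execution n) (t : nat) (p q : 'I_n) : Prop :=
  q \in suspect (state e t.+1 p).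

Definition strong_completeness n (F : pattern n) (e : execution n) : Prop :=
  exists t, forall t', t <= t' -> forall q p, q \in crashed F ->
    p \in correct F -> suspects e t' p q.

Definition strong_accuracy n (F : pattern n) (e : execution n) : Prop :=
  forall t p q, suspects e t p q -> q \in F t.

(* Main.v *)
(** Completeness: eventually the detector asks every correct process for exactly
    [#|correct F|] messages and crashed processes are no longer heard, so that
    every late round has AL equal to the set of correct processes; rounds never
    block because the correct processes alone provide enough messages.

    Accuracy: suppose that p ran rounds L, ..., L + f + 2 with the same AL and
    now suspects a process that is alive.  By realism AL has at least as many
    elements as there were processes alive when round L ended, so it contains a
    process that had already crashed then, and that had nevertheless sent
    (ALIVE, L + f + 2).  In round L + f + 1 this process did not hear from p,
    so it heard from a process that had crashed even earlier, and so on; this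
    gives more than f crashed processes. *)

Require Import Defs.
From mathcomp Require Import all_boot.
From mathcomp Require Import boolp zify.

Lemma eventually_all (T : finType) (P : T -> nat -> Prop) :
  (forall i s t, s <= t -> P i s -> P i t) ->
  (forall i, exists t, P i t) -> exists t, forall i, P i t.
Proof.
move=> Pmono /choice[g Pg]; exists (\max_i g i) => i.
exact: Pmono (leq_bigmax i) (Pg i).
Qed.

Section Run.

Context {n f : nat} {F : pattern n} {H : history n} {e : execution n}.
Context (fpF : failure_pattern f F) (HN : detector_N F H).
Context (run : execution_of f F H e).

Local Notation rnd t p := (round (state e t p)).

(** * Crashes, rounds and messages along a run *)

Lemma crash_mono s t : s <= t -> F s \subset F t.
Proof.
case: fpF => Fmono _ _; move/subnK => <-.
by elim: (t - s) => // k IH; rewrite addSn; exact: subset_trans IH (Fmono _).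
Qed.

Lemma crash_crashed t : F t \subset crashed F.
Proof. by apply/subsetP => p pF; rewrite inE; apply/asboolP; exists t. Qed.

Lemma correct_alive t p : p \in correct F -> p \notin F t.
Proof.
by rewrite inE; apply: contraNN; exact: (subsetP (crash_crashed t)).
Qed.

Definition proceeds t p (AL : {set 'I_n}) :=
  [/\ p \in active e t, todo (state e t p) = set0,
      AL \subset rcvd e t p (rnd t p), #|AL| = n - H p t
    & state e t.+1 p = next_round f AL (state e t p)].

Definition same_round (s s' : lstate n) :=
  [/\ round s' = round s, suspect s' = suspect s,
      earlieralive s' = earlieralive s & lastchange s' = lastchange s].

Lemma active_alive t p : p \in active e t -> p \notin F t.
Proof. by case: run => _ /(_ t p) + _ _ _ => /[swap] ->; case. Qed.

Lemma inactive_state t p : p \notin active e t -> state e t.+1 p = state e t p.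
Proof. by case: run => _ /(_ t p) + _ _ _ => /[swap] /negPf->; case. Qed.

Lemma active_step t p : p \in active e t -> takes_step f H e t p.
Proof. by case: run => _ /(_ t p) + _ _ _ => /[swap] ->; case. Qed.

Lemma proceeds_or_same t p :
  (exists AL, proceeds t p AL) \/ same_round (state e t p) (state e t.+1 p).
Proof.
have [pa|/inactive_state->] := boolP (p \in active e t); last by right.
have [D [+ _]] := active_step _ _ pa.
move def_s': (state e t.+1 p) => s'; move def_s: (state e t p) => s st.
case: st def_s' => [D' _ _|AL td0 ALg cAL|_ _] def_s'; [by right| |by right].
by left; exists AL; split; rewrite // def_s.
Qed.

Lemma rnd_step t p : rnd t p <= rnd t.+1 p.
Proof.
by case: (proceeds_or_same t p) => [[AL [_ _ _ _ ->]]/=|[-> _ _ _]].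
Qed.

Lemma rnd_mono p s t : s <= t -> rnd s p <= rnd t p.
Proof.
move/subnK => <-; elim: (t - s) => // k IH.
by rewrite addSn; exact: leq_trans IH (rnd_step _ _).
Qed.

Lemma crashed_state p s t : s <= t -> p \in F s -> state e t p = state e s p.
Proof.
move=> + ps; move/subnK => <-; elim: (t - s) => // k IH.
rewrite addSn inactive_state //; apply/negP => /active_alive/negP; apply.
by apply: (subsetP (crash_mono s _ _)) ps; rewrite leq_addl.
Qed.

Lemma sentE t p r :
  sent e t p r = if r < rnd t p then setT
                 else if r == rnd t p then ~: todo (state e t p) else set0.
Proof.
elim: t r => [|t IH] r.
  case: run => /(_ p)[-> /(_ r)[-> _]] _ _ _ _ /=.
  by case: eqP => //; rewrite setCT.
have [pa|pa] := boolP (p \in active e t); last first.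
  rewrite inactive_state // -IH.
  by case: run => _ /(_ t p) + _ _ _; rewrite (negPf pa) => -[_ ->].
have [D [+ ->]] := active_step _ _ pa; rewrite IH.
move def_s': (state e t.+1 p) => s'; move def_s: (state e t p) => s st.
case: st => [D' D't _|AL td0 _ _|td0 _] /=.
- case: ltngtP => // _; rewrite ?setTU ?setU0 //.
  by apply/setP => x; rewrite !inE; case: (x \in D'); case: (x \in todo s).
- rewrite td0 if_same setU0 setC0 setCT ltnS.
  by case: ltngtP => //; rewrite if_same.
- by rewrite if_same setU0.
Qed.

Lemma sent_round t p q r : q \in sent e t p r -> r <= rnd t p.
Proof. by rewrite sentE; case: ltngtP => //; rewrite inE. Qed.

Lemma rcvd_mono p r s t : s <= t -> rcvd e s p r \subset rcvd e t p r.
Proof.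
move/subnK => <-; elim: (t - s) => // k IH.
rewrite addSn; apply: subset_trans IH _.
by case: run => _ _ /(_ (k + s) p r)[].
Qed.

Lemma sent_step t p r : sent e t p r \subset sent e t.+1 p r.
Proof.
have [pa|pa] := boolP (p \in active e t).
  by have [D [_ ->]] := active_step _ _ pa; exact: subsetUl.
case: run => _ /(_ t p) + _ _ _; rewrite (negPf pa) => -[_ ->].
exact: subxx.
Qed.

Lemma rcvd_sent t p q r : q \in rcvd e t p r -> p \in sent e t q r.
Proof.
elim: t => [|t IH]; first by case: run => /(_ p)[_ /(_ r)[_ ->]]; rewrite inE.
move=> q_rcvd; apply: (subsetP (sent_step t q r)).
have [/IH//|q_new] := boolP (q \in rcvd e t p r).
case: run => _ _ /(_ t p r)[_ /(_ q)] + _ _.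
by rewrite in_setD q_new q_rcvd => -[].
Qed.

Lemma rcvd_round t p q r : q \in rcvd e t p r -> r <= rnd t q.
Proof. by move/rcvd_sent/sent_round. Qed.

Lemma lastchange_round t p : lastchange (state e t p) <= rnd t p.
Proof.
elim: t => [|t IH]; first by case: run => /(_ p)[->].
case: (proceeds_or_same t p) => [[AL [_ _ _ _ ->]]/=|[-> _ _ ->] //].
by case: ifP => _; lia.
Qed.

Lemma round_completed p k t :
  k < rnd t p -> exists u AL, [/\ u < t, rnd u p = k & proceeds u p AL].
Proof.
elim: t => [|t IH]; first by case: run => /(_ p)[->].
case: (proceeds_or_same t p) => [[AL pAL]|[-> _ _ _]]; last first.
  by move/IH => [u [AL [ut uk pr]]]; exists u, AL; split=> //; exact: leqW.
case: (pAL) => _ _ _ _ -> /=; rewrite ltnS leq_eqVlt => /orP[/eqP->|].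
  by exists t, AL.
by move/IH => [u [AL' [ut uk pr]]]; exists u, AL'; split=> //; exact: leqW.
Qed.

Lemma card_setC_AL p t (AL : {set 'I_n}) : #|AL| = n - H p t -> #|~: AL| = H p t.
Proof.
by move=> cAL; have := cardsC AL; rewrite card_ord; have := ltn_ord (H p t); lia.
Qed.

(** * Liveness: correct processes pass through every round *)

Lemma next_active t p : p \in correct F ->
  exists t', [/\ t <= t', state e t' p = state e t p & p \in active e t'].
Proof.
move=> pc; case: run => _ _ _ _ /(_ p pc t)[t' /subnK<-].
move: (t' - t) => k; elim: k t => [|k IH] t pa; first by exists t.
have [pt|pt] := boolP (p \in active e t); first by exists t.
have [|t2 [tt2 st2 pt2]] := IH t.+1; first by rewrite addnS.
by exists t2; rewrite st2 inactive_state //; split=> //; exact: ltnW.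
Qed.

Lemma broadcast_completes t p : p \in correct F ->
  exists t', [/\ t <= t', rnd t' p = rnd t p & todo (state e t' p) = set0].
Proof.
move=> pc; have [m] := ubnP #|todo (state e t p)|.
elim: m t => // m IH t; have [t1 [tt1 <- pa]] := next_active t p pc.
have [D [+ _]] := active_step t1 p pa.
move def_s': (state e t1.+1 p) => s'; move def_s: (state e t1 p) => s st.
case: st def_s' => [D' D't D'0|AL td0 _ _|td0 _] def_s' lem; last 2 first.
- by exists t1; rewrite def_s.
- by exists t1; rewrite def_s.
have [|t' [t1t' rt' td]] := IH t1.+1.
  rewrite def_s' /= -ltnS; apply: leq_trans lem; rewrite ltnS.
  rewrite proper_card // properEneq subsetDl andbT.
  apply: contraNneq D'0 => /setDidPl; rewrite disjoint_sym => dis.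
  by have := disjoint_setI0 dis; rewrite (setIidPl D't) => ->.
by exists t'; rewrite rt' def_s' td; split=> //; lia.
Qed.

Lemma detector_stable :
  exists T, forall t p, T <= t -> p \in correct F -> n - H p t = #|correct F|.
Proof.
case: HN => -[T Tcompl] acc; exists T => t p Tt pc.
have -> : H p t = #|crashed F| :> nat.
  by apply/eqP; rewrite eqn_leq acc ?Tcompl.
by rewrite /correct; have := cardsC (crashed F); rewrite card_ord; lia.
Qed.

(** Once all correct processes have reached round r, they complete its broadcast and hear each
    other. This supplies the number of messages that the stable detector requests, so all of them
    move on. *)
Lemma round_unbounded r :
  exists t, forall p, p \in correct F -> r <= rnd t p.
Proof.
have [T0 HT0] := detector_stable.
elim: r => [|r [T1 IH]]; first by exists 0.
have [T2 rcvdT2] : exists t, forall pq : 'I_n * 'I_n,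
    pq.1 \in correct F -> pq.2 \in correct F -> pq.2 \in rcvd e t pq.1 r.
  apply: eventually_all => [[p q] s t st /= Ps pc qc|[p q] /=].
    exact: (subsetP (rcvd_mono p r s t st)) (Ps pc qc).
  have [pc|pc] := boolP (p \in correct F); last by exists 0.
  have [qc|qc] := boolP (q \in correct F); last by exists 0.
  have [t p_sent] : exists t, p \in sent e t q r.
    have [t1 [T1t1 _ td]] := broadcast_completes T1 q qc.
    exists t1; rewrite sentE td setC0.
    have := leq_trans (IH q qc) (rnd_mono q _ _ T1t1).
    by case: ltngtP => //; rewrite inE.
  case: run => _ _ _ /(_ t q p r pc p_sent)[t' q_rcvd] _.
  by exists t'.
pose T := maxn T0 (maxn T1 T2).
apply: eventually_all => [p s t st rs pc|p].
  exact: leq_trans (rs pc) (rnd_mono p _ _ st).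
have [pc|pc] := boolP (p \in correct F); last by exists 0.
have [t1 [Tt1 rt1 td]] := broadcast_completes T p pc.
have [t2 [t12 st2 pa]] := next_active t1 p pc.
have : r <= rnd t2 p.
  by apply: leq_trans (IH p pc) (rnd_mono p _ _ _); lia.
rewrite leq_eqVlt => /orP[/eqP r_eq|r_lt]; last by exists t2.
exists t2.+1 => _; have [D [+ _]] := active_step t2 p pa.
rewrite HT0 //; last by lia.
move def_s': (state e t2.+1 p) => s' st.
case: st def_s' => [D' D't D'0|AL _ _ _|_ got_lt] def_s' /=.
- by move: D't D'0; rewrite st2 td subset0 => ->.
- by rewrite -r_eq.
- move: got_lt; rewrite -r_eq ltnNge subset_leq_card //.
  apply/subsetP => q qc; apply: (subsetP (rcvd_mono p r T2 t2 _)); first lia.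
  exact: (rcvdT2 (p, q)).
Qed.

(** * Strong completeness *)

Lemma crash_all : exists T, F T = crashed F.
Proof.
have [T PT] : exists t, forall q, q \in crashed F -> q \in F t.
  apply: eventually_all => [q s t st Ps qc|q].
    exact: (subsetP (crash_mono s t st)) (Ps qc).
  rewrite inE; case: asboolP => [[t qt]|_]; [by exists t | by exists 0].
by exists T; apply/eqP; rewrite eqEsubset crash_crashed; apply/subsetP.
Qed.

(* Crashed processes send only finitely many messages, so that in late rounds
   only correct processes can be heard, and the detector asks for all of
   them. *)
Lemma late_proceeds : exists R, forall t p AL, p \in correct F ->
  R <= rnd t p -> proceeds t p AL -> AL = correct F.
Proof.
have [T0 HT0] := detector_stable; have [T1 FT1] := crash_all.
pose T := maxn T0 T1.
(* This round exceeds all rounds reached by time T: a process in it is past T, and a process crashed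
   by T never sends its message. *)
exists (\max_q rnd T q).+1 => t p AL pc Rt [_ _ ALr cAL _].
have Tt : T <= t.
  rewrite leqNgt; apply/negP => /ltnW/(rnd_mono p).
  by have := leq_bigmax (F := fun q => rnd T q) p; lia.
have T0t : T0 <= t by lia.
apply/eqP; rewrite eqEcard cAL HT0 // leqnn andbT.
apply/subsetP => q /(subsetP ALr)/rcvd_round rq; rewrite in_setC.
apply/negP; rewrite -FT1 => qT1.
have qT : q \in F T by apply: (subsetP (crash_mono T1 T _)) qT1; lia.
move: rq; rewrite (crashed_state q T t) //.
by have := leq_bigmax (F := fun q => rnd T q) q; lia.
Qed.

Lemma run_strong_completeness : strong_completeness F e.
Proof.
have [R lateR] := late_proceeds.
have [T rT] := round_unbounded (R + f + 3).
(* AL is constant from round R on, so the last change is at R at the latest; round R + f + 2 then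
   sets [suspect], which shows in the round after it. *)
have inv t p : p \in correct F -> let s := state e t p in
    (R < round s -> earlieralive s = correct F /\ lastchange s <= R) /\
    (R + f + 2 < round s -> suspect s = crashed F).
  move=> pc; elim: t => [|t [IH1 IH2]] /=; first by case: run => /(_ p)[->].
  case: (proceeds_or_same t p) => [[AL pAL]|[-> -> -> ->] //].
  have ALc := lateR t p AL pc _ pAL; case: (pAL) => _ _ _ _ -> /=.
  have lc := lastchange_round t p.
  split; rewrite ltnS => rt.
    split; first exact: ALc.
    move: rt; rewrite leq_eqVlt => /orP[/eqP rt|Rt].
      by case: ifP => _; lia.
    by have [-> lcR] := IH1 Rt; rewrite ALc ?eqxx //; exact: ltnW.
  have [|-> lcR] := IH1; first lia.
  by rewrite ALc ?eqxx /= ?ifT ?setCK //; lia.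
exists T => t Tt q p qc pc; rewrite /suspects.
have [_ ->//] := inv t.+1 p pc.
apply: leq_trans (leq_trans (rT p pc) (rnd_mono p T t.+1 _)); lia.
Qed.

(** * Strong accuracy *)

Section Realistic.

Context (real : realistic f F H).

(* A realistic output must fit the pattern in which nobody crashes after t. *)
Lemma realistic_accuracy t p : p \notin F t -> H p t <= #|F t|.
Proof.
move=> pt; case: fpF => Fmono Fcorr Ff.
pose F' s := F (minn s t).
have cF' : crashed F' = F t.
  apply/setP => q; rewrite inE; apply/asboolP/idP => [[s]|qt].
    by apply: (subsetP (crash_mono _ _ _)); exact: geq_minr.
  by exists t; rewrite /F' minnn.
have fpF' : failure_pattern f F'.
  split; first by move=> s; apply: crash_mono; lia.
    rewrite /correct cF'; apply: contraNneq Fcorr => E.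
    by rewrite -subset0 -E setCS crash_crashed.
  by rewrite cF'; apply: leq_trans (subset_leq_card (crash_crashed t)) Ff.
have [|H' [[_ acc] H'E]] := real t F' fpF'.
  by move=> s st; rewrite /F' (minn_idPl st).
by rewrite -H'E // -cF'; apply: acc; rewrite in_setC cF'.
Qed.

(** Counting: the complement of AL has at most [#|F t|] elements and already contains the live
    process q, so it cannot contain all of [F t]. *)
Lemma crashed_heard p t (AL : {set 'I_n}) q :
  p \notin F t -> #|AL| = n - H p t -> q \notin AL -> q \notin F t ->
  exists2 a, a \in AL & a \in F t.
Proof.
move=> pt cAL qAL qt.
have [dis|/pred0Pn[a /andP[aAL aF]]] := boolP [disjoint AL & F t]; last first.
  by exists a.
have : #|q |: F t| <= #|~: AL|.
  by rewrite subset_leq_card // subUset sub1set in_setC qAL -disjoints_subset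
    disjoint_sym.
by rewrite cardsU1 qt (card_setC_AL p t) //; have := realistic_accuracy t p pt; lia.
Qed.

(* A crashed process a that ran k + 1 rounds ahead of p completed its round
   L + k without hearing from p, hence heard from a process that crashed
   earlier than a and ran k rounds ahead of p. *)
Lemma crashed_ahead p L k u a : p \notin F u -> rnd u p <= L -> a \in F u ->
  L + k < rnd u a -> k < #|F u|.
Proof.
elim: k u a => [|k IH] u a pu pL au ra; first by apply/card_gt0P; exists a.
rewrite addnS in ra.
have [v [AL [vu ra' [a_act _ ALr cAL _]]]] :
    exists v AL, [/\ v < u, rnd v a = (L + k).+1 & proceeds v a AL].
  exact: round_completed.
have av := active_alive v a a_act.
have vFu : F v \subset F u by apply: crash_mono; exact: ltnW.
have pv : p \notin F v by apply: contraNN pu; exact: (subsetP vFu).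
have pvL : rnd v p <= L by apply: leq_trans (rnd_mono p v u _) pL; lia.
have pAL : p \notin AL.
  apply/negP => /(subsetP ALr)/rcvd_round; rewrite ra'; lia.
have [b bAL bv] := crashed_heard a v AL p av cAL pAL pv.
have rb : L + k < rnd v b by have := rcvd_round _ _ _ _ (subsetP ALr b bAL); lia.
(* The inclusion of [F v] in [F u] is strict because a still took a step at v. *)
apply: leq_ltn_trans (IH v b pv pvL bv rb) _.
by apply/proper_card/properP; split=> //; exists a.
Qed.

(** This ties the size of the current [earlieralive] to the detector output at the time u of its
    last change, so that [crashed_heard] applies at u. *)
Lemma lastchange_proceeds t p : 0 < rnd t p -> let s := state e t p in
  exists u, [/\ u < t, p \notin F u, rnd u p = lastchange s
              & #|earlieralive s| = n - H p u].
Proof.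
elim: t => [|t IH] /=; first by case: run => /(_ p)[->].
case: (proceeds_or_same t p) => [[AL pAL]|[-> _ -> ->]]; last first.
  by move/IH => [u [ut pu ru cu]]; exists u; split=> //; exact: leqW.
case: (pAL) => /(active_alive t p) pt _ _ cAL -> _ /=.
case: ifPn => [_|/negPn/eqP AL_ea]; first by exists t.
(* In round 0, AL may equal the initial empty [earlieralive]; then [lastchange] is 0 and the current
   step is the witness. *)
have [r0|/IH[u [ut pu ru cu]]] := posnP (rnd t p).
  by exists t; split=> //; have := lastchange_round t p; lia.
by exists u; rewrite AL_ea; split=> //; exact: leqW.
Qed.

Lemma new_suspect_crashed t p AL q : proceeds t p AL ->
  AL = earlieralive (state e t p) ->
  lastchange (state e t p) + f + 2 <= rnd t p -> q \notin AL -> q \in F t.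
Proof.
move=> [_ _ ALr _ _] AL_ea Lr qAL; apply/negPn/negP => qt.
have [|u [ut pu ru]] := lastchange_proceeds t p; first lia.
rewrite -AL_ea => cAL.
have uFt := subsetP (crash_mono u t (ltnW ut)).
have qu : q \notin F u by apply: contraNN qt; exact: uFt.
have [a aAL au] := crashed_heard p u AL q pu cAL qAL qu.
have ra := rcvd_round _ _ _ _ (subsetP ALr a aAL).
(* The state of a is frozen from u on, so a was already in the later round when p was at its last
   change. *)
rewrite (crashed_state a u t (ltnW ut) au) in ra.
have : f < #|F u| by apply: (crashed_ahead p (rnd u p) f u a); rewrite ?ru //; lia.
case: fpF => _ _; have := subset_leq_card (crash_crashed u); lia.
Qed.

Lemma run_strong_accuracy : strong_accuracy F e.
Proof.
have stepwise t p q : (q \in suspect (state e t p) -> q \in F t) ->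
    q \in suspect (state e t.+1 p) -> q \in F t.
  move=> IH; case: (proceeds_or_same t p) => [[AL pAL]|[_ -> _ _] //].
  case: (pAL) => _ _ _ _ -> /=; case: eqP => //= AL_ea; case: ifP => // Lr.
  by rewrite in_setC; exact: new_suspect_crashed pAL AL_ea Lr.
move=> t p q; apply: (stepwise).
elim: t => [|t IH]; first by case: run => /(_ p)[->]; rewrite inE.
by move/(stepwise t p q IH); exact: (subsetP (crash_mono t t.+1 _)).
Qed.

End Realistic.

End Run.

Theorem theorem3p5 (n f : nat) (F : pattern n) (H : history n)
    (e : execution n) :
  failure_pattern f F -> detector_N F H -> execution_of f F H e ->
  strong_completeness F e /\ (realistic f F H -> strong_accuracy F e).
Proof.
move=> fpF HN run; split; first exact: run_strong_completeness fpF HN run.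
by move=> real; exact: run_strong_accuracy fpF run real.
Qed.
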